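(* Let $1<p<\infty$, let $X$ be a Banach space, let $(A,D(A))$ be the generator of a $C_0$-semigroup $(T(t))_{t\ge0}$ on $X$ such that $T(t)$ is a compact operator for each $t>0$, and let $f:\mathbb{R}\times X\to X$ be such that for all $R>0$ the function $t\mapsto\sup_{\|x\|\le R}\|f(t,x)\|$ belongs to $L^p_{loc}(\mathbb{R},\mathbb{R})$ and $$\sup_{t\in\mathbb{R}}\Big(\int_t^{t+1}\sup_{\|x\|\le R}\|f(s,x)\|^p\,ds\Big)^{1/p}<+\infty .$$ If $x_0:[t_0,+\infty)\to X$ (for some $t_0\in\mathbb{R}$) is a bounded mild solution of the equation $x'(t)=Ax(t)+f(t,x(t))$, then its range $\{x_0(t): t\ge t_0\}$ is relatively compact in $X$.
   Context: Standing assumption: $f:\mathbb{R}\times X\to X$ is locally $p$-integrable in its first argument and continuous in its second argument. Mild solution on $[t_0,\infty)$: a continuous $x:[t_0,\infty)\to X$ with $x(t)=T(t-\sigma)x(\sigma)+\int_\sigma^t T(t-s)f(s,x(s))\,ds$ for all $t\ge\sigma\ge t_0$. *)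

(* Defs.v *)
From HB Require Import structures.
From mathcomp Require Import all_boot all_order all_algebra.
From mathcomp Require Import all_classical all_reals all_analysis.
From mathcomp Require Import measurable_realfun.

Set Implicit Arguments.
Unset Strict Implicit.
Unset Printing Implicit Defensive.

Import Order.TTheory GRing.Theory Num.Theory.
Import numFieldNormedType.Exports.

Local Open Scope classical_set_scope.
Local Open Scope ring_scope.

(** * The Bochner integral

    The definitions follow Diestel and Uhl, _Vector Measures_, ch. II. *)

Definition is_simple d (T : measurableType d) (R : realType)
    (X : normedModType R) (mu : {measure set T -> \bar R}) (D : set T)
    (s : {fimfun T >-> X}) : Prop :=
  forall v : X, measurable (s @^-1` [set v]) /\
    (v != 0 -> (mu (D `&` s @^-1` [set v]) < +oo)%E).

Definition simple_integral d (T : measurableType d) (R : realType)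
    (X : normedModType R) (mu : {measure set T -> \bar R}) (D : set T)
    (s : {fimfun T >-> X}) : X :=
  \sum_(v \in range s) fine (mu (D `&` s @^-1` [set v])) *: v.

Definition strongly_measurable d (T : measurableType d) (R : realType)
    (X : normedModType R) (mu : {measure set T -> \bar R}) (D : set T)
    (g : T -> X) : Prop :=
  exists s : nat -> {fimfun T >-> X},
    (forall n, is_simple mu D (s n)) /\
    {ae mu, forall t, D t -> s n t @[n --> \oo] --> g t}.

Definition simple_approx d (T : measurableType d) (R : realType)
    (X : normedModType R) (mu : {measure set T -> \bar R}) (D : set T)
    (g : T -> X) (s : nat -> {fimfun T >-> X}) : Prop :=
  (forall n, is_simple mu D (s n)) /\
  (\int[mu]_(t in D) (`|g t - s n t|%:E))%E @[n --> \oo] --> 0%E.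

Definition bochner_integrable d (T : measurableType d) (R : realType)
    (X : normedModType R) (mu : {measure set T -> \bar R}) (D : set T)
    (g : T -> X) : Prop :=
  strongly_measurable mu D g /\ exists s, simple_approx mu D g s.

(* For [X] complete and [g] integrable the limit exists and does not depend on
   the approximating sequence; otherwise the value is not meaningful. *)
Definition bochner_integral d (T : measurableType d) (R : realType)
    (X : normedModType R) (mu : {measure set T -> \bar R}) (D : set T)
    (g : T -> X) : X :=
  get [set v : X | exists2 s, simple_approx mu D g s &
                     simple_integral mu D (s n) @[n --> \oo] --> v].

(* Lebesgue measure on the Lebesgue (not merely Borel) measurable sets. *)
Notation leb R := (@completed_lebesgue_measure R).

(** * Semigroups of operators *)

(* Only the operators [T t] with [0 <= t] are constrained, here and below. *)
Record is_C0_semigroup (R : realType) (X : normedModType R)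
    (T : R -> {linear X -> X}) : Prop := IsC0Semigroup {
  C0_continuous : forall t, 0 <= t -> continuous (T t) ;
  C0_zero : forall x, T 0 x = x ;
  C0_add : forall s t x, 0 <= s -> 0 <= t -> T (s + t) x = T s (T t x) ;
  C0_strong : forall x, T t x @[t --> 0^'+] --> x
}.

(* The unbounded operator (A, D(A)) is given by its domain [D] and by a total
   function [A] whose values outside [D] are irrelevant. *)
Definition is_generator (R : realType) (X : normedModType R)
    (T : R -> {linear X -> X}) (D : set X) (A : X -> X) : Prop :=
  D = [set x | cvg ((h^-1 *: (T h x - x)) @[h --> 0^'+])] /\
  forall x, D x -> h^-1 *: (T h x - x) @[h --> 0^'+] --> A x.

Definition compact_operator (R : realType) (X : normedModType R)
    (L : {linear X -> X}) : Prop :=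
  forall B : set X, bounded_set B -> precompact (L @` B).

(** * The nonlinearity *)

Definition locally_p_integrable (R : realType) (X : normedModType R) (p : R)
    (g : R -> X) : Prop :=
  forall a b : R,
    strongly_measurable (leb R) `[a, b] g /\
    (\int[leb R]_(t in `[a, b]) ((`|g t| `^ p)%:E) < +oo)%E.

Definition Lp_on d (T : measurableType d) (R : realType)
    (mu : {measure set T -> \bar R}) (p : R) (D : set T)
    (h : T -> \bar R) : Prop :=
  measurable_fun D h /\ (\int[mu]_(t in D) (`|h t| `^ p) < +oo)%E.

(* Finiteness of the integrals forces [h] to be finite almost everywhere, so [h]
   represents an element of L^p_loc(R, R). *)
Definition Lp_loc (R : realType) (p : R) (h : R -> \bar R) : Prop :=
  forall a b : R, Lp_on (leb R) p `[a, b] h.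

Definition sup_norm_ball (R : realType) (X : normedModType R)
    (f : R -> X -> X) (r t : R) : \bar R :=
  ereal_sup [set (`|f t x|)%:E | x in [set x : X | `|x| <= r]].

(** * Mild solutions *)

(* A function on [t0, +oo[ is represented by a total function [x], of which only
   the restriction to [t0, +oo[ matters. *)
Definition is_mild_solution (R : realType) (X : completeNormedModType R)
    (T : R -> {linear X -> X}) (f : R -> X -> X) (t0 : R) (x : R -> X) : Prop :=
  {within `[t0, +oo[, continuous x} /\
  forall s t : R, t0 <= s -> s <= t ->
    bochner_integrable (leb R) `[s, t] (fun r => T (t - r) (f r (x r))) /\
    x t = T (t - s) (x s) +
          bochner_integral (leb R) `[s, t] (fun r => T (t - r) (f r (x r))).

(* Main.v *)
(**
Fix [eta > 0].  A mild solution satisfies, for [t >= t0 + e],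
  [x t = T e (x (t - e)) + int_(t - e)^t T (t - s) (f s (x s)) ds].
The first term stays in [T e (x [t0, +oo[)], which is precompact because [T e] is
compact and [x] is bounded.  For small [e] the operators [T h], [0 <= h <= e], are
bounded uniformly (Banach-Steinhaus), so the norm of the integral is at most a
multiple of [int_(t - e)^t phi], where [phi s] is the supremum of [`|f s y|] over a
ball containing the range of [x]; the uniform local [L^p] bound on [phi] with
[p > 1] makes this smaller than [eta] uniformly in [t].  Hence the range of [x] is
within [eta] of a precompact set, namely [x [t0, t0 + e]] united with
[T e (x [t0, +oo[)].
*)

Require Import Defs.
From HB Require Import structures.
From mathcomp Require Import all_boot all_order all_algebra.
From mathcomp Require Import all_classical all_reals all_analysis.
From mathcomp Require Import measurable_realfun lra.

Set Implicit Arguments.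
Unset Strict Implicit.
Unset Printing Implicit Defensive.

Import Order.TTheory GRing.Theory Num.Theory.
Import numFieldNormedType.Exports.

Local Open Scope classical_set_scope.
Local Open Scope ring_scope.

(** * Precompactness by approximation *)

(** Since [X] is complete, it is enough that every ultrafilter [F] containing [closure C] is Cauchy.
    Moving each point to a nearby point of [K] sends [F] to a filter with a cluster point [q] in
    [closure K]; as [F] is an ultrafilter, it then contains the ball of radius [e] around [q]. *)
Lemma precompact_approx (R : realType) (X : completeNormedModType R)
    (C : set X) :
  (forall e : R, 0 < e -> exists2 K : set X, precompact K &
     forall x, C x -> exists2 y, K y & `|x - y| <= e) ->
  precompact C.
Proof.
move=> approx; rewrite precompactE compact_ultra => F FU FC.
have PF : ProperFilter F by exact: ultra_proper.
suff: cvg F.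
  move=> /cvg_ex[p Fp]; exists p; split => //.
  exact: (@closed_cvg _ _ F _ id _ (@closed_closure _ C) FC p Fp).
apply: cauchy_cvg; apply: cauchy_exP => e e0.
have e30 : 0 < e / 3 by rewrite divr_gt0.
have [K cK CK] := approx _ e30.
(* One third goes from the closure to [C], one from [C] to [K]; the last is kept for the distance to
   [q]. *)
have clCK x : closure C x -> exists2 y, K y & `|x - y| < e / 3 + e / 3.
  move=> /(_ _ (nbhsx_ballx x _ e30))[z [/CK[y Ky zy]]].
  rewrite -ball_normE /= => xz; exists y => //.
  by rewrite (le_lt_trans (ler_distD z _ _))// ltr_leD.
have /choice[phi phiP] : forall x, exists y,
    closure C x -> K y /\ `|x - y| < e / 3 + e / 3.
  move=> x; have [/clCK[y Ky xy]|] := pselect (closure C x); last by exists 0.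
  by exists y.
have FphiK : F (phi @^-1` closure K).
  by apply: filterS FC => x /phiP[Kx _]; exact: subset_closure.
move: cK; rewrite precompactE => /(_ (phi @ F) _ FphiK)[q [_ qF]].
exists q; have [//|FN] := in_ultra_setVsetC (ball q e) FU.
have : F (phi @^-1` (~` ball q (e / 3))).
  apply: filterS (filterI FC FN) => x [/phiP[_ xphi] /= + ].
  apply: contra_not; rewrite -ball_normE /= => qphi.
  rewrite (le_lt_trans (ler_distD (phi x) _ _))//.
  rewrite [ltRHS](_ : e = e / 3 + (e / 3 + e / 3)); last by lra.
  by rewrite ltrD// distrC.
by move=> /(qF (~` ball q (e / 3)))/(_ (nbhsx_ballx q _ e30))[y []].
Qed.

(** * Uniform boundedness of a semigroup near time zero *)

(** Otherwise there are times tending to 0 along which the operator norms are unbounded. Strong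
    continuity makes these operators pointwise bounded, which contradicts Banach-Steinhaus. *)
Lemma C0_semigroup_bounded (R : realType) (X : completeNormedModType R)
    (T : R -> {linear X -> X}) :
  is_C0_semigroup T ->
  exists2 d : R, 0 < d & exists2 M : R, 0 < M &
    forall t, 0 <= t <= d -> forall x, `|T t x| <= M * `|x|.
Proof.
move=> C0T; apply: contrapT => unb.
have /choice[u uP] : forall n : nat, exists u : R * X,
    [/\ 0 < u.1, u.1 <= n.+1%:R^-1 & n.+1%:R * `|u.2| < `|T u.1 u.2|].
  move=> n; apply: contrapT => nu; apply: unb.
  exists n.+1%:R^-1; first by rewrite invr_gt0.
  exists n.+1%:R => // t /andP[t0 tn] x.
  (* At time 0 the identity satisfies the bound, so the bad times are positive and the one-sided
     limit [C0_strong] applies to them. *)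
  move: t0; rewrite le_eqVlt => /predU1P[<-|t0].
    by rewrite C0_zero// ler_peMl// ler1n.
  rewrite leNgt; apply/negP => Tx; apply: nu.
  by exists (t, x).
have u0 : (u n).1 @[n --> \oo] --> (0 : R).
  apply: (squeeze_cvgr _ (cvg_cst 0) cvg_harmonic).
  by near=> n; case: (uP n) => /ltW ->.
pose F := range (fun n => T (u n).1 : X -> X).
have [] := @Banach_Steinhauss _ _ _ F _ _ 1.
- move=> _ [n _ <-]; split; last exact: linearP.
  apply/bounded_funP/linear_bounded_continuous/C0_continuous => //.
  by apply: ltW; case: (uP n).
- move=> x.
  have /cvgP/cvg_seq_bounded : T (u n).1 x @[n --> \oo] --> x.
    have u0r : (u n).1 @[n --> \oo] --> (0 : R)^'+.
      move=> P /u0 uP0; rewrite /= nbhs_filterE /=.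
      by apply: (@filterS _ \oo _ _ _ _ uP0) => n; apply; case: (uP n).
    have Tx := @C0_strong _ _ _ C0T x.
    exact: (@cvg_comp _ _ _ (fun n => (u n).1) (T^~ x) _ _ _ u0r Tx).
  move=> /pinfty_ex_gt0[M M0 bM]; exists M => _ [n _ <-].
  exact: bM.
- move=> M bM.
  (* An index [n] above the absolute value of [M] violates the bound on the unit ball at the
     normalised vector. *)
  have /archi_boundP Mn := normr_ge0 M.
  set n := Num.bound `|M| in Mn.
  have [_ _] := uP n; set x := (u n).2 => nx.
  have x0 : 0 < `|x|.
    rewrite normr_gt0; apply: contraTN nx => /eqP ->.
    by rewrite linear0 normr0 mulr0 ltxx.
  have /= := bM _ (imageP _ (I : setT n)) (`|x|^-1 *: x).
  rewrite linearZ /= !normrZ ger0_norm ?invr_ge0// mulVf ?gt_eqF//.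
  move=> /(_ (lexx _)).
  rewrite ler_pdivrMl// leNgt => /negP; apply; rewrite (lt_trans _ nx)//.
  rewrite mulrC ltr_pM2r// (le_lt_trans (ler_norm _))// (lt_trans Mn)//.
  by rewrite ltr_nat.
Unshelve. all: by end_near. Qed.

(** * Integrals of functions with finite range *)

Section finite_range.
Context d (T : measurableType d) (I : choiceType) (q : T -> I).
Hypothesis finq : finite_set (range q).
Hypothesis mq : forall i, measurable (q @^-1` [set i]).

Lemma measurable_fun_finite_range d' (U : measurableType d') (phi : I -> U)
    (D : set T) :
  measurable_fun D (phi \o q).
Proof.
move=> mD B _; apply: measurableI => //.
rewrite [X in measurable X](_ : _ =
    \bigcup_(i in range q `&` phi @^-1` B) (q @^-1` [set i])).
  by apply: fin_bigcup_measurable => // ; exact: finite_setIl.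
apply/seteqP; split=> [t Bt|t [i [_ Bi] /= ->//]].
by exists (q t) => //; split=> //; exists t.
Qed.

Context (R : realType) (mu : {measure set T -> \bar R}) (D : set T).
Hypothesis mD : measurable D.

Lemma integral_finite_range (phi : I -> R) : (forall i, 0 <= phi i) ->
  (\int[mu]_(t in D) (phi (q t))%:E =
   \sum_(i \in range q) (phi i)%:E * mu (D `&` q @^-1` [set i]))%E.
Proof.
move=> phi0.
have mqD i : measurable_fun D (fun t => (\1_(q @^-1` [set i]) t)%:E : \bar R).
  by apply/measurable_EFinP; exact: measurable_indic.
transitivity (\int[mu]_(t in D)
    (\sum_(i \in range q) (phi i)%:E * (\1_(q @^-1` [set i]) t)%:E))%E.
  apply: eq_integral => t _; rewrite (fsbigD1 (q t))//=; last by exists t.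
  rewrite indicE mem_set// mule1 fsbig1 ?adde0// => i [_ /= qi].
  by rewrite indicE memNset ?mule0//= => /esym.
rewrite ge0_integral_fsum//.
- apply: eq_fsbigr => i _; rewrite ge0_integralZl_EFin//.
  by rewrite integral_indic// setIC.
- by move=> i; apply: measurable_funeM.
- by move=> i t _; rewrite -EFinM lee_fin mulr_ge0.
Qed.

Hypothesis muD : (mu D < +oo)%E.

Let fin_num_muI (A : set T) : measurable A -> mu (D `&` A) \is a fin_num.
Proof.
move=> mA; rewrite ge0_fin_numE// (le_lt_trans _ muD)// le_measure ?inE//.
exact: measurableI.
Qed.

(** This passes to a finer partition: each fibre of [pi \o q] is a finite union of fibres of [q],
    and after exchanging the sums only [v = pi i] contributes for a given [i]. Finiteness of [mu D]
    lets [fine] commute with the sums. *)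
Lemma sum_fiber_comp (X : normedModType R) (pi : I -> X) :
  \sum_(v \in range (pi \o q))
     fine (mu (D `&` (pi \o q) @^-1` [set v])) *: v =
  \sum_(i \in range q) fine (mu (D `&` q @^-1` [set i])) *: pi i.
Proof.
have muE v : fine (mu (D `&` (pi \o q) @^-1` [set v])) =
    \sum_(i \in range q) (pi i == v)%:R * fine (mu (D `&` q @^-1` [set i])).
  have mpi : measurable ((pi \o q) @^-1` [set v]).
    rewrite (_ : _ @^-1` _ =
        setT `&` ((fun i => pi i == v) \o q) @^-1` [set true]).
      exact: measurable_fun_finite_range.
    by rewrite setTI; apply/seteqP; split => t /= /eqP.
  apply: EFin_inj; rewrite fineK ?fin_num_muI// -fsumEFin//.
  rewrite setIC -integral_indic//.
  under eq_integral => t _.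
    rewrite indicE (_ : (t \in _) = (pi (q t) == v)); last first.
      by apply/idP/eqP => [/set_mem//|qt]; exact/mem_set.
    over.
  rewrite (@integral_finite_range (fun i => (pi i == v)%:R))//.
  by apply: eq_fsbigr => i _; rewrite EFinM fineK// fin_num_muI.
have finpi : finite_set (range (pi \o q)).
  by rewrite -(image_comp q pi); apply: finite_image.
under eq_fsbigr => v _.
  rewrite muE fsbig_finite//= scaler_suml -fsbig_finite//; over.
rewrite exchange_fsbig//; apply: eq_fsbigr => i /set_mem[t _ <-].
rewrite (fsbigD1 (pi (q t)))//=; last by exists t.
rewrite eqxx mul1r fsbig1 ?addr0// => v [_ /= /nesym/eqP/negbTE].
by move=> ->; rewrite mul0r scale0r.
Qed.

End finite_range.

(** * Comparison of integrals of simple functions *)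

Section simple_integral.
Context d (T : measurableType d) (R : realType) (X : normedModType R).
Context (mu : {measure set T -> \bar R}) (D E : set T).
Context (s s' : {fimfun T >-> X}).
Hypothesis ms : is_simple mu D s.
Hypothesis ms' : is_simple mu D s'.

Let q t := (s t, s' t).

Let finq : finite_set (range q).
Proof.
apply: (@sub_finite_set _ _ (range s `*` range s')).
  by move=> _ [t _ <-]; split; exists t.
by apply: finite_setX; exact: fimfunP.
Qed.

Let mq i : measurable (q @^-1` [set i]).
Proof.
case: i => v v'; rewrite (_ : _ @^-1` _ = s @^-1` [set v] `&` s' @^-1` [set v']).
  by apply: measurableI; [have [] := ms v|have [] := ms' v'].
by apply/seteqP; split => t /=; [case=> -> ->|case=> <- <-].
Qed.

Lemma measurable_fun_simple_norm :
  measurable_fun E (fun t => `|s t - s' t|%:E).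
Proof.
exact: (measurable_fun_finite_range finq mq (fun v => `|v.1 - v.2|%:E)).
Qed.

(* Both integrals are rewritten as sums over the range of [t |-> (s t, s' t)], so
   that they can be subtracted term by term. *)
Lemma simple_integral_dist : measurable D -> (mu D < +oo)%E ->
  (`|simple_integral mu D s - simple_integral mu D s'|%:E <=
   \int[mu]_(t in D) `|s t - s' t|%:E)%E.
Proof.
move=> mD muD.
have -> : simple_integral mu D s =
    \sum_(i \in range q) fine (mu (D `&` q @^-1` [set i])) *: i.1.
  exact: (sum_fiber_comp finq mq mD muD fst).
have -> : simple_integral mu D s' =
    \sum_(i \in range q) fine (mu (D `&` q @^-1` [set i])) *: i.2.
  exact: (sum_fiber_comp finq mq mD muD snd).
rewrite (@integral_finite_range _ _ _ q finq mq _ mu _ mD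
  (fun i => `|i.1 - i.2|))//.
rewrite !fsbig_finite//= -sumrB.
rewrite (eq_bigr (fun i => fine (mu (D `&` q @^-1` [set i])) *: (i.1 - i.2)));
  last by move=> i _; rewrite scalerBr.
rewrite [leRHS](eq_bigr (fun i : X * X =>
    (fine (mu (D `&` q @^-1` [set i])) * `|i.1 - i.2|)%:E)); last first.
  move=> i _; rewrite EFinM muleC fineK// ge0_fin_numE//.
  by rewrite (le_lt_trans _ muD)// le_measure ?inE//; exact: measurableI.
rewrite sumEFin lee_fin (le_trans (ler_norm_sum _ _ _))//.
by apply: ler_sum => i _; rewrite normrZ ger0_norm// fine_ge0.
Qed.

End simple_integral.

(** * Norm estimate for the Bochner integral *)

Section bochner.
Context d (T : measurableType d) (R : realType) (X : completeNormedModType R).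
Context (mu : {measure set T -> \bar R}) (D : set T).
Hypothesis cmu : measure_is_complete mu.
Hypothesis mD : measurable D.
Hypothesis muD : (mu D < +oo)%E.

(** The function agrees almost everywhere with an upper limit of measurable functions, and
    completeness of [mu] transfers measurability. *)
Lemma measurable_fun_strong_norm (g : T -> X) (s : {fimfun T >-> X}) :
  strongly_measurable mu D g -> is_simple mu D s ->
  measurable_fun D (fun t => `|g t - s t|%:E).
Proof.
move=> [u [mu_ ug]] ms.
pose f t := limn_esup (fun n => `|u n t - s t|%:E).
apply: (@ae_measurable_fun _ _ _ mu cmu _ f); last first.
  apply: measurable_fun_limn_esup => n.
  exact: measurable_fun_simple_norm (mu_ n) ms.
apply: filterS ug => t ugt Dt.
apply: (cvg_limn_einf_sup _).2; apply: cvg_EFin; first by near=> n.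
apply: cvg_norm; apply: cvgB; [exact: ugt|exact: cvg_cst].
Unshelve. all: by end_near. Qed.

Lemma simple_approx_near (g : T -> X) (s : nat -> {fimfun T >-> X}) (e : R) :
  simple_approx mu D g s -> 0 < e ->
  \forall n \near \oo, (\int[mu]_(t in D) `|g t - s n t|%:E < e%:E)%E.
Proof.
move=> [_ s0] e0; apply: (s0 [set x | (x < e%:E)%E]).
by apply: open_nbhs_nbhs; split; [exact: open_ereal_lt_ereal|rewrite /= lte_fin].
Qed.

(** The integrals form a Cauchy sequence, by the triangle inequality through [g]. This provides the
    limit that [bochner_integral] selects. *)
Lemma simple_integral_cvg (g : T -> X) (s : nat -> {fimfun T >-> X}) :
  strongly_measurable mu D g -> simple_approx mu D g s ->
  cvg (simple_integral mu D (s n) @[n --> \oo]).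
Proof.
move=> mg gs; have [ms _] := gs.
apply: cauchy_cvg; apply: cauchy_exP => e e0.
have e20 : 0 < e / 2 by rewrite divr_gt0.
have [N _ sN] := simple_approx_near gs e20.
exists (simple_integral mu D (s N)); exists N => // n /= Nn.
rewrite -ball_normE /= -lte_fin.
rewrite (le_lt_trans (simple_integral_dist (ms N) (ms n) mD muD))//.
rewrite (splitr e) EFinD (le_lt_trans _ (lteD (sN N _) (sN n _)))//=.
have mN m : measurable_fun D (fun t => `|g t - s m t|%:E).
  exact: measurable_fun_strong_norm.
rewrite -ge0_integralD//; apply: ge0_le_integral => //.
- exact: measurable_fun_simple_norm (ms N) (ms n).
- exact: emeasurable_funD.
- by move=> t _; rewrite -EFinD lee_fin (distrC (g t)) ler_distD.
Qed.

(** The value chosen by [get] is a limit along some approximating sequence [s]; the estimate is made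
    for [s n] and costs [e / 2] for the limit and [e / 2] for replacing [s n] by [g]. *)
Lemma norm_bochner_integral_le (g : T -> X) (h : T -> \bar R) :
  bochner_integrable mu D g ->
  measurable_fun D h -> (forall t, D t -> (`|g t|%:E <= h t)%E) ->
  (`|bochner_integral mu D g|%:E <= \int[mu]_(t in D) h t)%E.
Proof.
move=> [mg [u gu]] mh gh.
have /getPex[s gs] : [set v : X | exists2 s, simple_approx mu D g s &
    simple_integral mu D (s n) @[n --> \oo] --> v] !=set0.
  by exists (lim (simple_integral mu D (u n) @[n --> \oo])); exists u => //;
    exact: simple_integral_cvg mg gu.
rewrite -/(bochner_integral mu D g); set v := bochner_integral _ _ _ => sv.
have [ms _] := gs.
(* Comparing [s n] with the zero function bounds the norm of its integral. *)
have ms0 : is_simple mu D (cst (0 : X)).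
  move=> w.
  have m0 : measurable ((cst (0 : X) : T -> X) @^-1` [set w]).
    by rewrite preimage_cst; case: ifP.
  split=> // _; rewrite (le_lt_trans _ muD)// le_measure ?inE//.
  exact: measurableI.
apply/lee_addgt0Pr => e e0; have e20 : 0 < e / 2 by rewrite divr_gt0.
have /cvgrPdist_lt/(_ _ e20) sve := sv.
have [n [gn vn]] := filter_ex (filterI (simple_approx_near gs e20) sve).
rewrite (splitr e) EFinD addeA.
rewrite (@le_trans _ _ (`|simple_integral mu D (s n)|%:E + (e / 2)%:E)%E)//.
  by rewrite -EFinD lee_fin -lerBlDl (le_trans (lerB_dist _ _))// ltW.
rewrite leeD2r//.
have := simple_integral_dist (ms n) ms0 mD muD.
have -> : simple_integral mu D (cst (0 : X)) = 0.
  by rewrite /simple_integral fsbig1// => _ [t _ <-]; rewrite scaler0.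
rewrite subr0 => /le_trans; apply.
rewrite (le_trans _ (leeD2l _ (ltW gn)))//.
rewrite -ge0_integralD//; last 2 first.
- by move=> t Dt; rewrite (le_trans _ (gh t Dt)).
- exact: measurable_fun_strong_norm.
apply: ge0_le_integral => //.
- exact: measurable_fun_simple_norm (ms n) ms0.
- by apply: emeasurable_funD => //; exact: measurable_fun_strong_norm.
move=> t Dt; rewrite /= subr0 (le_trans _ (leeD2r _ (gh t Dt)))//.
by rewrite -EFinD lee_fin -lerBlDl distrC (le_trans (lerB_dist _ _))// distrC.
Qed.

End bochner.

(** * Uniformly small integrals over short intervals *)

(** Above the level [K], write [y] as [y ^ (1 - p)] times [y ^ p] and use that [1 - p] is negative;
    at [+oo] both sides are infinite. *)
Lemma le_cst_add_poweR (R : realType) (p K : R) (y : \bar R) :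
  1 < p -> 0 < K -> (0 <= y)%E ->
  (y <= K%:E + (K `^ (1 - p))%:E * y `^ p)%E.
Proof.
move=> p1 K0; have p0 : p != 0 by rewrite gt_eqF// (lt_trans _ p1).
case: y => [r| |//]; last first.
  by rewrite poweRyr// gt0_muley ?lte_fin ?powR_gt0// addey.
rewrite lee_fin => r0; rewrite poweR_EFin -EFinM -EFinD lee_fin.
have [rK|Kr] := leP r K.
  by rewrite (le_trans rK)// lerDl mulr_ge0// powR_ge0.
have {}r0 : 0 < r by exact: lt_trans Kr.
rewrite -[leLHS]add0r lerD//; first exact: ltW.
rewrite -opprB powRN mulrC ler_pdivlMr ?powR_gt0//.
rewrite -[X in r `^ X](subrK 1) (@powRD _ r) ?(gt_eqF r0) ?implybT//.
rewrite powRr1 ?(ltW r0)//.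
by rewrite mulrC ler_pM2r// ge0_ler_powR ?nnegrE ?subr_ge0 ?ltW.
Qed.

Notation lebesgueType R := (caratheodory_type (wlength (R:=R) idfun)^*%mu).

Lemma measurable_lebesgue_itv (R : realType) (a b : R) :
  measurable (`[a, b] : set (lebesgueType R)).
Proof. by apply: sub_caratheodory; exact: measurable_itv. Qed.

Lemma completed_lebesgue_measure_itvcc (R : realType) (a b : R) :
  a <= b -> leb R `[a, b] = (b - a)%:E.
Proof.
move=> ab; transitivity (lebesgue_measure (`[a, b]%classic : set R)) => //.
rewrite lebesgue_measure_itv/= lte_fin -EFinB; case: ltgtP ab => // -> _.
by rewrite subrr.
Qed.

(* Integrating [le_cst_add_poweR] over an interval of length [e] gives the bound
   [K e + K `^ (1 - p) B]; this replaces Hoelder's inequality. *)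
Lemma small_integral_of_bounded_poweR (R : realType) (p B eta : R)
    (h : R -> \bar R) :
  1 < p -> 0 <= B -> 0 < eta -> (forall t, (0 <= h t)%E) ->
  (forall a b : R, measurable_fun (`[a, b] : set (lebesgueType R)) h) ->
  (forall t : R, (\int[leb R]_(s in `[t, (t + 1)%R]) (h s `^ p) <= B%:E)%E) ->
  exists2 del : R, 0 < del & forall t e : R, 0 < e <= del ->
    (\int[leb R]_(s in `[(t - e)%R, t]) h s <= eta%:E)%E.
Proof.
move=> p1 B0 eta0 h0 mh hB.
have p10 : 0 < p - 1 by rewrite subr_gt0.
have eta20 : 0 < eta / 2 by rewrite divr_gt0.
(* [K] is chosen so that [K ^ (p - 1) = C], whence [K ^ (1 - p) * B = B / C <= eta / 2]; the added 1
   keeps [C] positive when [B = 0]. *)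
pose C := B / (eta / 2) + 1.
have C0 : 0 < C by rewrite ltr_wpDl// divr_ge0// ltW.
pose K := C `^ (p - 1)^-1.
have K0 : 0 < K by rewrite powR_gt0.
have KB : K `^ (1 - p) * B <= eta / 2.
  rewrite -opprB powRN -powRrM mulVf ?gt_eqF// powRr1 ?(ltW C0)//.
  rewrite ler_pdivrMl// /C mulrDl mul1r divfK ?gt_eqF//.
  by rewrite lerDl ltW.
(* The bound 1 places the interval inside the unit interval starting at [t - e]; the other gives
   [K * e <= eta / 2]. *)
exists (Num.min 1 (eta / 2 / K)).
  by rewrite lt_min ltr01 divr_gt0.
move=> t e /andP[e0]; rewrite le_min => /andP[e1 eK].
have mI (a b : R) := @measurable_lebesgue_itv R a b.
have mhp (a b : R) :
    measurable_fun (`[a, b] : set (lebesgueType R)) (fun s => (h s `^ p)%E).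
  exact: (measurableT_comp (measurable_poweR p)).
have K1p : (0 <= (K `^ (1 - p))%:E)%E by rewrite lee_fin powR_ge0.
apply: (@le_trans _ _ (\int[leb R]_(s in `[(t - e)%R, t])
    (K%:E + (K `^ (1 - p))%:E * h s `^ p))%E).
  apply: ge0_le_integral => //.
  - apply: emeasurable_funD; first exact: measurable_cst.
    by apply: measurable_funeM.
  - by move=> s _; exact: le_cst_add_poweR.
rewrite ge0_integralD//; first last.
- by apply: measurable_funeM.
- by move=> s _; rewrite mule_ge0// poweR_ge0.
- by move=> s _; rewrite lee_fin ltW.
rewrite (splitr eta) EFinD leeD//.
  have te : t - e <= t by rewrite gerBl ltW.
  rewrite integral_cst// [X in (_ * X)%E](completed_lebesgue_measure_itvcc te).
  by rewrite opprB addrC subrK -EFinM lee_fin mulrC -ler_pdivlMr.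
rewrite ge0_integralZl//; last by move=> s _; rewrite poweR_ge0.
apply: (@le_trans _ _ ((K `^ (1 - p))%:E * B%:E)%E); last first.
  by rewrite -EFinM lee_fin.
rewrite lee_wpmul2l// (le_trans _ (hB (t - e)))//.
apply: ge0_subset_integral => //; first by move=> s _; exact: poweR_ge0.
move=> s /=; rewrite !in_itv/= => /andP[-> st]/=.
by rewrite (le_trans st)// -lerBlDr lerD2l lerN2.
Qed.

(** * Bounds for the nonlinearity on balls *)

Lemma sup_norm_ball_ge (R : realType) (X : normedModType R) (f : R -> X -> X)
    (r t : R) (x : X) :
  `|x| <= r -> (`|f t x|%:E <= sup_norm_ball f r t)%E.
Proof. by move=> xr; apply: ereal_sup_ubound; exists x. Qed.

Lemma sup_norm_ball_ge0 (R : realType) (X : normedModType R) (f : R -> X -> X)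
    (r t : R) :
  0 <= r -> (0 <= sup_norm_ball f r t)%E.
Proof.
move=> r0; apply: (@le_trans _ _ (`|f t 0|%:E)); first by rewrite lee_fin.
by apply: sup_norm_ball_ge; rewrite normr0.
Qed.

Lemma poweR_sup_bound (R : realType) (p : R) (I : Type) (u : I -> \bar R) :
  0 < p -> (forall i, (0 <= u i)%E) ->
  (ereal_sup [set (u i `^ p^-1)%E | i in [set: I]] < +oo)%E ->
  exists2 B : R, 0 <= B & forall i, (u i <= B%:E)%E.
Proof.
set S := ereal_sup _ => p0 u0 Soo.
exists (fine S `^ p); first exact: powR_ge0.
move=> i.
(* The index [i] also shows that [S] is nonnegative, hence real; over an empty [I] it would be
   [-oo]. *)
have uS : (u i `^ p^-1 <= S)%E by apply: ereal_sup_ubound; exists i.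
have S0 : (0 <= S)%E by rewrite (le_trans _ uS)// poweR_ge0.
rewrite -poweR_EFin fineK ?ge0_fin_numE//.
have <- : ((u i `^ p^-1) `^ p = u i)%E.
  by rewrite -poweRrM mulVf ?gt_eqF// poweRe1.
by apply: (gt0_ler_poweR (ltW p0)) uS; rewrite in_itv/= ?poweR_ge0 ?S0 leey.
Qed.

(** * Relative compactness of the range *)

Unset Implicit Arguments.

Theorem lemma3p6 (R : realType) (p : R) (X : completeNormedModType R)
    (T : R -> {linear X -> X}) (D : set X) (A : X -> X)
    (f : R -> X -> X) (t0 : R) (x0 : R -> X) :
  1 < p ->
  is_C0_semigroup T ->
  is_generator T D A ->
  (forall t : R, 0 < t -> compact_operator (T t)) ->
  (forall x : X, locally_p_integrable p (f ^~ x)) ->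
  (forall t : R, continuous (f t)) ->
  (forall r : R, 0 < r ->
     Lp_loc p (sup_norm_ball f r) /\
     (ereal_sup [set ((\int[leb R]_(s in `[t, (t + 1)%R]) (sup_norm_ball f r s `^ p))
                        `^ (p^-1)%R) | t in [set: R]] < +oo)%E) ->
  is_mild_solution T f t0 x0 ->
  bounded_set (x0 @` `[t0, +oo[) ->
  precompact (x0 @` `[t0, +oo[).
Proof.
move=> p1 C0T _ cT _ _ fLp [cx0 mild] bx0.
have p0 : 0 < p by rewrite (lt_trans _ p1).
have [r r0 x0r] := pinfty_ex_gt0 bx0.
have [Lph suph] := fLp r r0.
have h0 t : (0 <= sup_norm_ball f r t)%E by rewrite sup_norm_ball_ge0// ltW.
have [|B B0 hB] := poweR_sup_bound p0 _ suph.
  by move=> t; apply: integral_ge0 => s _; exact: poweR_ge0.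
have [d d0 [M M0 TM]] := C0_semigroup_bounded C0T.
apply: precompact_approx => eta eta0.
(* The target is [eta / M] because the semigroup bound multiplies the integral by [M]. *)
have [del del0 hdel] := small_integral_of_bounded_poweR p1 B0
  (divr_gt0 eta0 M0) h0 (fun a b => (Lph a b).1) hB.
pose e := Num.min d del.
have e0 : 0 < e by rewrite lt_min d0.
(* The initial arc, compact by continuity, covers the times for which [t - e] may precede [t0]. *)
exists (x0 @` `[t0, t0 + e] `|` T e @` (x0 @` `[t0, +oo[)).
  rewrite precompactE closureU; apply: compactU; rewrite -precompactE.
    apply: compact_precompact; first exact: norm_hausdorff.
    apply: continuous_compact; last exact: segment_compact.
    apply: continuous_subspaceW cx0 => s /=.
    by rewrite !in_itv/= => /andP[->].
  exact: cT.
move=> _ [t + <-]; rewrite /= in_itv/= andbT => t0t.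
have [te|te] := leP t (t0 + e).
  exists (x0 t); last by rewrite subrr normr0 ltW.
  by left; exists t => //=; rewrite in_itv/= t0t.
have t0te : t0 <= t - e by rewrite lerBrDr ltW.
exists (T e (x0 (t - e))).
  by right; exists (x0 (t - e)) => //; exists (t - e) => //=; rewrite in_itv/= t0te.
have te_t : t - e <= t by rewrite gerBl ltW.
have [gint ->] := mild _ _ t0te te_t.
rewrite subKr addrC addKr -lee_fin.
have M_ge0 : (0 <= M%:E)%E by rewrite lee_fin ltW.
have mI := @measurable_lebesgue_itv R (t - e) t.
have hM : measurable_fun (`[t - e, t] : set (lebesgueType R))
    (fun s => (M%:E * sup_norm_ball f r s)%E).
  by apply: measurable_funeM; exact: (Lph _ _).1.
rewrite (le_trans (norm_bochner_integral_le _ _ _ gint hM _))//.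
- exact: completed_lebesgue_measure_is_complete.
- by rewrite [X in (X < _)%E](completed_lebesgue_measure_itvcc te_t) ltry.
- move=> s; rewrite /= in_itv/= => /andP[tes st].
  (* Here [t - s] lies between 0 and [e <= d], so the semigroup bound applies. *)
  apply: (@le_trans _ _ (M * `|f s (x0 s)|)%:E).
    rewrite lee_fin TM// subr_ge0 st/= (@le_trans _ _ e)//; last first.
      by rewrite ge_min lexx.
    by rewrite lerBlDl -lerBlDr.
  rewrite EFinM lee_wpmul2l// sup_norm_ball_ge// x0r//.
  by exists s => //=; rewrite in_itv/= andbT (le_trans t0te).
rewrite ge0_integralZl//; last exact: (Lph _ _).1.
rewrite -[leRHS](_ : M%:E * (eta / M)%:E = _)%E; last first.
  by rewrite -EFinM mulrC divfK ?gt_eqF.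
by rewrite lee_wpmul2l// hdel// e0 ge_min lexx orbT.
Qed.
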